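(* Let $k$ be an algebraically closed field, let $m\ge 1$, and let $A = k[x_1,\dots,x_m]$. Let $f\in A$ be an irreducible polynomial, let $n=p$ be a prime number that is invertible in $k$, and let $T = A[z]/(z^p-f)$. Then $T^\ast = k^\ast$.
   Context: For a commutative ring $B$, $B^\ast$ denotes its group of units. The ring $T$ is the coordinate ring of the affine variety $z^p=f$ in $\mathbb A^{m+1}$; it is an integrally closed integral domain containing $k$. *)

(* Defs.v *)
From mathcomp Require Import all_boot all_algebra.
From mathcomp Require Import mpoly.

Set Implicit Arguments.
Unset Strict Implicit.
Unset Printing Implicit Defensive.

Import GRing.Theory.
Open Scope ring_scope.

Definition irreducible_elt (R : idomainType) (a : R) : Prop :=
  [/\ a != 0, a \isn't a GRing.unit
    & forall b c : R, a = b * c ->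
        b \is a GRing.unit \/ c \is a GRing.unit].

(* GRing.unit requires a unitRingType; {poly %/ h} has such a structure only
   over a field. *)
Definition is_unit (R : comNzRingType) (u : R) : Prop :=
  exists v : R, v * u = 1.

Lemma is_unitP (R : comUnitRingType) (u : R) :
  is_unit u <-> u \is a GRing.unit.
Proof.
split=> [[v vu1]|uU]; last by exists u^-1; rewrite mulVr.
by apply/unitrP; exists v; split; rewrite // mulrC.
Qed.

(* {poly %/ h} is the quotient by h only when h is monic and nonconstant
   (otherwise it is the quotient by 'X); the next two lemmas check that
   {poly %/ 'X^n - a%:P} really is R['X] / ('X^n - a). *)
Lemma mk_monic_XnsubC (R : nzRingType) (n : nat) (a : R) :
  (0 < n)%N -> mk_monic ('X^n - a%:P) = 'X^n - a%:P.
Proof.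
by move=> n_gt0; rewrite /mk_monic size_XnsubC // ltnS n_gt0 monicXnsubC.
Qed.

Lemma in_qpoly_XnsubC_presentation (R : comNzRingType) (n : nat) (a : R) :
  (0 < n)%N ->
  let h := 'X^n - a%:P in
  (forall u : {poly %/ h}, exists q : {poly R}, u = in_qpoly h q) /\
  (forall q : {poly R}, in_qpoly h q = 0 <-> exists r : {poly R}, q = r * h).
Proof.
move=> n_gt0 h; have hE : mk_monic h = h by exact: mk_monic_XnsubC.
split=> [u|q].
  by exists u; apply/val_inj/esym/in_qpoly_small/size_mk_monic.
have hM : h \is monic by rewrite -hE monic_mk_monic.
split=> [/(congr1 val) /= q0|[r ->]].
  exists (Pdiv.CommonRing.rdivp q h); rewrite hE in q0.
  by rewrite [LHS](Pdiv.RingMonic.rdivp_eq hM) q0 addr0.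
by apply: val_inj; rewrite /= hE Pdiv.RingMonic.rmodp_mull.
Qed.

(* Main.v *)
Require Import Defs.
From Stdlib Require Import Classical_Prop.
From HB Require Import structures.
From mathcomp Require Import all_boot all_algebra.
From mathcomp Require Import ring zify.
From mathcomp Require Import mpoly.

Set Implicit Arguments.
Unset Strict Implicit.
Unset Printing Implicit Defensive.

Import GRing.Theory.
Local Open Scope ring_scope.

(** Write A = k[x_1, .., x_m], T = A[z]/(z^p - f), let zeta be a primitive p-th
    root of unity in k and s the A-automorphism z |-> zeta z of T, with norm
    N(x) = x s(x) ... s^(p-1)(x), which lies in A.

    Reduction to principal units.  If x is a unit of T then N(x) is a unit of A,
    hence a constant c.  Modulo z the automorphism s is trivial, so x mod z is
    a p-th root of c in the domain T/(z) = A/(f); as k contains all the p-th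
    roots of c, x mod z is a constant.  Dividing by it leaves a principal unit:
    N(u) = 1 and u = 1 mod z ([unit_scale]).  It remains to see that the group
    U of principal units is trivial.

    U is divisible by 1 - s ([hilbert90]).  The sum v of the products
    u s(u) ... s^(i-1)(u), i < p, satisfies u s(v) = v, and v = p mod z, so
    that f does not divide N(v).  The ideal (v) is s-stable, hence extended from
    A up to ramification, and only z ramifies:
    a prime q of A that divides N(v) is not f, and then q divides v itself
    ([prime_divides_coef]).  Removing these primes, which does not affect the
    equation u s(v) = v, one is left with a unit v, normalised to lie in U.

    U is divisible by p ([principal_unit_pth_power]).  Each u in U is
    (1 - s)^(p-1) y with y in U, and (1 - s)^(p-1) = 1 + s + ... + s^(p-1)
    modulo p, where the right-hand side is the norm and kills U.

    U has bounded divisibility.  Give z the degree deg(f)/p.  The resulting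
    degree function h on T satisfies h(w^p) = p h(w), because the associated
    graded ring, T with f replaced by its leading form, is reduced when
    p is invertible ([weight_drops_pred]).  A p-divisible group on which h takes
    values in the multiples of 1/p has h = 0, and elements with h = 0 are
    constants ([principal_unit_weight], [weight_le0_const]).

    All of this holds for a factorial domain A with an additive degree function
    whose elements of degree 0 are constants ([radical_units]).  That
    irreducible elements of k[x_1, .., x_m] are prime is obtained from Gauss's
    lemma by induction on m ([irreducible_is_prime_mpoly]). *)

(** * Divisibility, primes and Gauss's lemma *)

Definition divides (R : comNzRingType) (a b : R) : Prop := exists d, b = d * a.

Definition prime_elt (R : idomainType) (a : R) : Prop :=
  a \isn't a GRing.unit /\
  forall b c, divides a (b * c) -> divides a b \/ divides a c.

Definition irreducible_is_prime (R : idomainType) : Prop :=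
  forall a : R, irreducible_elt a -> prime_elt a.

Section Divides.
Variable R : comNzRingType.
Implicit Types a b c : R.

Lemma divides0 a : divides a 0.
Proof. by exists 0; rewrite mul0r. Qed.

Lemma divides_refl a : divides a a.
Proof. by exists 1; rewrite mul1r. Qed.

Lemma dividesD a b c : divides a b -> divides a c -> divides a (b + c).
Proof. by move=> [x ->] [y ->]; exists (x + y); rewrite mulrDl. Qed.

Lemma dividesMl a b c : divides a c -> divides a (b * c).
Proof. by move=> [x ->]; exists (b * x); rewrite mulrA. Qed.

Lemma dividesMr a b c : divides a b -> divides a (b * c).
Proof. by rewrite mulrC; apply: dividesMl. Qed.

Lemma dividesN a b : divides a b -> divides a (- b).
Proof. by move=> [x ->]; exists (- x); rewrite mulNr. Qed.

Lemma dividesB a b c : divides a b -> divides a c -> divides a (b - c).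
Proof. by move=> ab ac; apply: dividesD => //; apply: dividesN. Qed.

Lemma divides_trans a b c : divides a b -> divides b c -> divides a c.
Proof. by move=> ab [x ->]; apply: dividesMl. Qed.

Lemma divides_sum a (I : Type) (r : seq I) (P : pred I) (F : I -> R) :
  (forall i, P i -> divides a (F i)) -> divides a (\sum_(i <- r | P i) F i).
Proof.
move=> aF; elim/big_ind: _ => //; [exact: divides0 | exact: dividesD].
Qed.

End Divides.

Lemma divides_unit (R : idomainType) (a b : R) :
  divides a b -> b \is a GRing.unit -> a \is a GRing.unit.
Proof. by move=> [x ->]; rewrite unitrM => /andP[]. Qed.

Lemma prime_divides_exp (R : idomainType) (a b : R) n :
  prime_elt a -> divides a (b ^+ n) -> divides a b.
Proof.
move=> [aN apr]; elim: n => [|n IH].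
  by rewrite expr0 => /divides_unit/(_ (unitr1 _)); rewrite (negPf aN).
by rewrite exprS => /apr[].
Qed.

Lemma prime_divides_prod (R : idomainType) (a : R) n (F : 'I_n -> R) :
  prime_elt a -> divides a (\prod_i F i) -> exists i, divides a (F i).
Proof.
move=> [aN apr]; elim: n F => [|n IH] F.
  by rewrite big_ord0 => /divides_unit/(_ (unitr1 _)); rewrite (negPf aN).
rewrite big_ord_recl => /apr[|/IH[i]]; first by exists ord0.
by exists (lift ord0 i).
Qed.

Lemma divides_irreducible (R : idomainType) (a b : R) :
  a \isn't a GRing.unit -> irreducible_elt b -> divides a b -> divides b a.
Proof.
move=> aN [b0 bN bi] [d bda].
case: (bi _ _ bda) => [du|]; last by rewrite (negPf aN).
by exists d^-1; rewrite bda mulKr.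
Qed.

Lemma divides_polyCP (R : comNzRingType) (q : R) (P : {poly R}) :
  divides q%:P P <-> forall i, divides q P`_i.
Proof.
split=> [[D ->] i|qP]; first by exists D`_i; rewrite coefMC.
rewrite -[P]coefK poly_def; apply: divides_sum => i _.
by have [d ->] := qP i; exists (d *: 'X^i);
  rewrite [RHS]mulrC mul_polyC scalerA mulrC.
Qed.

(** Gauss's lemma is proved for a domain in which irreducible elements are
    prime and a size function grows under multiplication by a nonunit; the
    latter replaces the ascending chain condition and gives existence of
    irreducible factors. *)
Section Gauss.

Variables (R : idomainType) (w : R -> nat).
Hypothesis w_lt :
  forall a b : R, a != 0 -> b != 0 -> b \isn't a GRing.unit ->
  (w a < w (a * b))%N.

Lemma irreducible_factor (a : R) :
  a != 0 -> a \isn't a GRing.unit ->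
  exists2 q, irreducible_elt q & divides q a.
Proof.
have [n] := ubnP (w a); elim: n a => // n IH a le_an a0 aN.
have [ai|aNi] := classic (irreducible_elt a).
  by exists a => //; apply: divides_refl.
have [b [c [abc bN cN]]] : exists b c,
    [/\ a = b * c, b \isn't a GRing.unit & c \isn't a GRing.unit].
  apply: NNPP => nex; apply: aNi; split=> // b c abc.
  have [bU|bN] := boolP (b \is a GRing.unit); first by left.
  have [cU|cN] := boolP (c \is a GRing.unit); first by right.
  by case: nex; exists b, c.
have [b0 c0] : b != 0 /\ c != 0.
  by apply/andP; rewrite -negb_or -mulf_eq0 -abc.
have [|q qi qb] := IH b _ b0 bN.
  by apply: leq_trans (w_lt b0 c0 cN) _; rewrite -abc.
by exists q => //; rewrite abc; apply: dividesMr.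
Qed.

Hypothesis ufdR : irreducible_is_prime R.

(** R[X]/(q) = (R/q)[X] is a domain.  Written out by splitting off the constant
    coefficients of both factors: q divides one of them, whose term can then be
    dropped. *)
Lemma prime_polyC (q : R) (G H : {poly R}) :
  prime_elt q -> divides q%:P (G * H) -> divides q%:P G \/ divides q%:P H.
Proof.
move=> [qN qpr].
have [n] := ubnP (size G + size H)%N; elim: n G H => // n IH G H.
have shift (P : {poly R}) : P != 0 ->
    exists P1 c, P = P1 * 'X + c%:P /\ (size P1 < size P)%N.
  elim/poly_ind: P => [|P1 c _]; first by rewrite eqxx.
  move=> P0; exists P1, c; split=> //; rewrite size_MXaddC.
  case: ifP => // /andP[/eqP P10 /eqP c0].
  by rewrite P10 c0 mul0r add0r eqxx in P0.
have [->|/shift[G1 [g [-> sG]]]] := eqVneq G 0; first by left; apply: divides0.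
have [->|/shift[H1 [h [-> sH]]]] := eqVneq H 0; first by right; apply: divides0.
have MX (P : {poly R}) c : divides q%:P (P * 'X + c%:P) <->
    divides q%:P P /\ divides q c.
  split=> [/divides_polyCP qP|[qP qc]].
    split; last by have := qP 0; rewrite coefD coefMX coefC add0r.
    apply/divides_polyCP => i; have := qP i.+1.
    by rewrite coefD coefMX coefC addr0.
  apply: dividesD; first exact: dividesMr.
  by case: qc => d ->; exists d%:P; rewrite polyCM.
move=> le_n qGH.
have : divides q (g * h).
  move/divides_polyCP/(_ 0): qGH.
  by rewrite coefM big_ord1 !coefD !coefMX !coefC !add0r.
have MXr (P Q : {poly R}) c : divides q%:P ((P * 'X + c%:P) * Q) ->
    divides q c -> divides q%:P (P * Q).
  move=> qPQ qc; suff /MX[] : divides q%:P (P * Q * 'X + 0%:P) by [].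
  have -> : P * Q * 'X + 0%:P = (P * 'X + c%:P) * Q - c%:P * Q by ring.
  apply: dividesB => //; apply: dividesMr.
  by case: qc => d ->; exists d%:P; rewrite polyCM.
case/qpr => [qg|qh].
  have /IH[|qG|qH] := MXr _ _ _ qGH qg; last by right.
    by rewrite -ltnS (leq_trans _ le_n) // ltnS ltn_add2r.
  by left; apply/MX.
rewrite mulrC in qGH; have /IH[|qH|qG] := MXr _ _ _ qGH qh; last by left.
  by rewrite -ltnS (leq_trans _ le_n) // ltnS addnC ltn_add2l.
by right; apply/MX.
Qed.

(** The primes of a constant c dividing a product of polynomials can be
    distributed among the factors.  This is the form of Gauss's lemma that
    clears the denominators of pseudo-divisions. *)
Lemma gauss_split (c : R) (F G H : {poly R}) :
  c != 0 -> c%:P * F = G * H ->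
  exists G' H' a b, [/\ F = G' * H', G = a%:P * G' & H = b%:P * H'].
Proof.
have [n] := ubnP (w c); elim: n c G H => // n IH c G H le_cn c0 cF.
have [cU|cN] := boolP (c \is a GRing.unit).
  exists (c^-1%:P * G), H, c, 1; split; last by rewrite mul1r.
    by rewrite -mulrA -cF mulrA -polyCM mulVr // mul1r.
  by rewrite mulrA -polyCM divrr // mul1r.
have [q qi [d cdq]] := irreducible_factor c0 cN.
have [q0 qN _] := qi.
have d0 : d != 0 by apply: contraNneq c0 => d0; rewrite cdq d0 mul0r.
have lt_d : (w d < n)%N by rewrite -ltnS (leq_trans _ le_cn) // ltnS cdq w_lt.
have qP0 : q%:P != 0 by rewrite polyC_eq0.
have : divides q%:P (G * H) by exists (d%:P * F); rewrite -cF cdq polyCM; ring.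
case/(prime_polyC (ufdR qi)) => [] [K KE].
  have [|G' [H' [a [b [-> KE' ->]]]]] := IH d K H lt_d d0.
    by apply: (mulIf qP0); rewrite [RHS]mulrAC -KE -cF cdq polyCM; ring.
  by exists G', H', (q * a), b; split=> //; rewrite KE KE' polyCM; ring.
have [|G' [H' [a [b [-> -> KE']]]]] := IH d G K lt_d d0.
  by apply: (mulIf qP0); rewrite -[RHS]mulrA -KE -cF cdq polyCM; ring.
by exists G', H', a, (q * b); split=> //; rewrite KE KE' polyCM; ring.
Qed.

Lemma irreducible_divides_content (g F : {poly R}) (c : R) :
  irreducible_elt g -> (1 < size g)%N -> c != 0 ->
  divides g (c%:P * F) -> divides g F.
Proof.
move=> [g0 gN gi] sg c0 [H]; rewrite mulrC => cF; move: cF; rewrite mulrC.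
move/(gauss_split c0) => [H' [g' [b [a [-> _ gE]]]]].
case: (gi _ _ gE) => [aU|].
  by exists (H' * a%:P^-1); rewrite gE mulrA mulrVK.
rewrite poly_unitE => /andP[/eqP sg' _].
have := size_polyMleq a%:P g'; rewrite -gE sg' addn1 /=.
by move/leq_trans/(_ (size_polyC_leq1 _)); rewrite leqNgt sg.
Qed.

(** Let g be a nonconstant irreducible dividing a b, and d a pseudo-gcd of g
    and a.  If d is constant, multiplying a Bezout relation by b shows that g
    divides a constant multiple of b; otherwise d is g up to constants, so that
    g divides a constant multiple of a.  Either way the constant cancels. *)
Lemma irreducible_is_prime_poly : irreducible_is_prime {poly R}.
Proof.
move=> g gi; have [g0 gN gf] := gi; split=> // a b.
have [/size1_polyC gC|sg] := leqP (size g) 1.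
  rewrite gC; apply: prime_polyC; apply: ufdR.
  have unitC (c : R) : (c%:P \is a GRing.unit) = (c \is a GRing.unit).
    rewrite poly_unitE coefC size_polyC /=.
    by case: (eqVneq c 0) => [->|//]; rewrite unitr0.
  split; first by rewrite -polyC_eq0 -gC.
    by rewrite -unitC -gC.
  by move=> x y gxy; rewrite -!unitC; apply: gf; rewrite gC gxy polyCM.
move=> [s abE]; set d := gcdp g a.
have d0 : d != 0 by rewrite gcdp_eq0 negb_and g0.
have [sd|sd] := leqP (size d) 1.
  have [[u v] /= /eqpP[[e1 e2] /= /andP[e10 e20] E]] := Bezoutp g a.
  move: sd E => /size1_polyC; rewrite -/d => dC; rewrite dC => E.
  have dn0 : d`_0 != 0 by rewrite -polyC_eq0 -dC.
  right; apply: (irreducible_divides_content gi sg (mulf_neq0 e20 dn0)).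
  exists (e1 *: (u * b + v * s)).
  transitivity ((e2 *: (d`_0)%:P) * b); first by rewrite -mul_polyC polyCM.
  rewrite -E -!scalerAl; congr (_ *: _).
  by rewrite !mulrDl -[v * s * g]mulrA -abE; ring.
left.
have /Pdiv.Idomain.dvdpP[[c1 h] /= c10 E1] := dvdp_gcdl g a.
have /Pdiv.Idomain.dvdpP[[c2 t] /= c20 E2] := dvdp_gcdr g a.
rewrite -/d -!mul_polyC in E1 E2.
have [h' [d' [e [al [gE hE dE]]]]] := gauss_split c10 E1.
have h'U : h' \is a GRing.unit.
  case: (gf _ _ gE) => //; rewrite poly_unitE => /andP[/eqP sd' _].
  have := size_polyMleq al%:P d'; rewrite -dE sd' addn1 /=.
  by move/leq_trans/(_ (size_polyC_leq1 _)); rewrite leqNgt sd.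
apply: (irreducible_divides_content gi sg c20).
exists (t * al%:P * h'^-1); rewrite E2 dE gE.
by rewrite -[RHS]mulrA mulKr // mulrA.
Qed.

End Gauss.

(** * Factoriality of multivariate polynomial rings *)

Lemma irreducible_is_prime_iso (R S : idomainType)
    (f : {rmorphism R -> S}) (g : {rmorphism S -> R}) :
  cancel f g -> cancel g f -> irreducible_is_prime S -> irreducible_is_prime R.
Proof.
move=> fK gK ufdS a [a0 aN afact].
have fU x : (f x \is a GRing.unit) = (x \is a GRing.unit).
  by apply/idP/idP => [/(rmorph_unit g)|/(rmorph_unit f)//]; rewrite fK.
have [|_ fa_pr] := ufdS (f a).
  split; first by apply: contraNneq a0 => /(congr1 g); rewrite fK rmorph0 => ->.
    by rewrite fU.
  move=> b c /(congr1 g); rewrite fK rmorphM => /afact.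
  by rewrite -!fU !gK.
split=> // b c [d bcE].
have [|[e]|[e]] := fa_pr (f b) (f c).
- by exists (f d); rewrite -!rmorphM bcE.
- by move/(congr1 g); rewrite rmorphM !fK => ->; left; exists (g e).
- by move/(congr1 g); rewrite rmorphM !fK => ->; right; exists (g e).
Qed.

Section LastVariable.

Variables (n : nat) (k : comNzRingType).

(** The inverse of [muni]: substitute the last variable for 'X. *)
Definition unmuni : {poly {mpoly k[n]}} -> {mpoly k[n.+1]} :=
  horner_eval 'X_ord_max \o map_poly (@mwiden n k).

HB.instance Definition _ := GRing.RMorphism.on unmuni.

Lemma muniX m : muni ('X_[m] : {mpoly k[n.+1]}) =
  'X_[[multinom m (widen_ord (leqnSn n) i) | i < n]] *: 'X^(m ord_max).
Proof. by rewrite muniE msuppX big_seq1 mcoeffX eqxx scale1r. Qed.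

Lemma unmuniC a : unmuni a%:P = mwiden a.
Proof. by rewrite /unmuni /= map_polyC /horner_eval hornerC. Qed.

Lemma unmuniX : unmuni 'X = 'X_ord_max.
Proof. by rewrite /unmuni /= map_polyX /horner_eval hornerX. Qed.

Lemma muniK : cancel (@muni n k) unmuni.
Proof.
move=> p; rewrite [p in RHS]mpolyE muniE rmorph_sum /=.
apply: eq_bigr => m _; rewrite -mul_polyC.
rewrite rmorphM rmorphXn /= unmuniX unmuniC mwidenZ mwidenX -scalerAl.
congr (_ *: _); rewrite mpolyXn -mpolyXD; congr 'X_[_].
apply/mnmP => i; rewrite mnmDE mulmnE mnm1E.
case: (unliftP ord_max i) => [j|] ->.
  have -> : lift ord_max j = widen_ord (leqnSn n) j.
    by apply: val_inj; rewrite /= /bump leqNgt ltn_ord.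
  rewrite mnmwiden_widen mnmE -(inj_eq val_inj) /=.
  by rewrite gtn_eqF ?mul0n ?addn0 /= ?ltn_ord.
by rewrite mnmwiden_ordmax eqxx mul1n.
Qed.

Lemma unmuniK : cancel unmuni (@muni n k).
Proof.
elim/poly_ind => [|q a IH]; first by rewrite !rmorph0.
rewrite !(rmorphD, rmorphM) /= IH unmuniX unmuniC; congr (_ * _ + _).
  rewrite muniX mnm1E eqxx expr1 (_ : [multinom _ | _ < _] = 0%MM).
    by rewrite mpolyX0 scale1r.
  by apply/mnmP => i; rewrite mnmE mnm1E mnm0E -(inj_eq val_inj) /= gtn_eqF.
elim/mpolyind: a => [|c m b _ _ IHb]; first by rewrite !rmorph0.
rewrite !rmorphD /= IHb mwidenZ mwidenX muniZ muniX mnmwiden_ordmax.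
rewrite expr0 alg_polyC -mul_polyC -polyCM mul_mpolyC.
congr ((_ *: 'X_[_])%:P + _).
by apply/mnmP => i; rewrite mnmE mnmwiden_widen.
Qed.

End LastVariable.

Lemma msizeM_lt (k : fieldType) n (a b : {mpoly k[n]}) :
  a != 0 -> b != 0 -> b \isn't a GRing.unit -> (msize a < msize (a * b))%N.
Proof.
move=> a0 b0 bN; rewrite msizeM // (mpolySpred _ a0) addSn /=.
rewrite -addn2 leq_add2l ltnNge; apply: contra bN => /msize1_polyC bC.
rewrite bC rmorph_unit // unitfE; apply: contraNneq b0 => b00.
by rewrite bC b00.
Qed.

Theorem irreducible_is_prime_mpoly (k : fieldType) n :
  irreducible_is_prime {mpoly k[n]}.
Proof.
elim: n => [|n IH]; last first.
  apply: (irreducible_is_prime_iso (@muniK n k) (@unmuniK n k)).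
  exact: (irreducible_is_prime_poly (@msizeM_lt k n) IH).
move=> a [a0 /negP[]]; have aC : a = (a@_0)%:MP.
  apply/mpolyP => m; rewrite mcoeffC (_ : m = 0%MM) ?eqxx ?mulr1 //.
  by apply/mnmP => -[].
rewrite aC rmorph_unit // unitfE; apply: contraNneq a0 => a00.
by rewrite aC a00.
Qed.

(** * The ring A[z]/(z^p - f) and its automorphisms *)

Section RadicalExtension.

Variables (A : comNzRingType) (p : nat) (f : A).
Hypothesis p_gt0 : (0 < p)%N.

Local Notation h := ('X^p - f%:P).
Local Notation T := {poly %/ h}.
Local Notation z := ('qX : T).
Implicit Types x y : T.

Let hE : mk_monic h = h := mk_monic_XnsubC f p_gt0.

Lemma size_radical x : (size x <= p)%N.
Proof.
by rewrite -ltnS (leq_trans (size_mk_monic x)) // hE size_XnsubC.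
Qed.

Lemma in_qpoly_radical x : in_qpoly h x = x.
Proof.
apply: val_inj; apply: in_qpoly_small; exact: size_mk_monic.
Qed.

Lemma in_qpoly_reduced (P : {poly A}) :
  (size P <= p)%N -> in_qpoly h P = P :> {poly A}.
Proof.
by move=> sP; rewrite in_qpoly_small // hE size_XnsubC.
Qed.

Lemma in_qpoly_modulus : in_qpoly h h = 0.
Proof.
apply/(proj2 (in_qpoly_XnsubC_presentation f p_gt0)).
by exists 1; rewrite mul1r.
Qed.

Lemma in_qpolyC (a : A) : in_qpoly h a%:P = a%:A.
Proof. by rewrite -(alg_polyC a) in_qpolyZ in_qpoly1. Qed.

Lemma qpolyC_alg (a : A) : qpolyC h a = a%:A.
Proof. by rewrite -in_qpolyC -[LHS]in_qpoly_radical. Qed.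

Lemma radicalX : z ^+ p = f%:A.
Proof.
apply/eqP; rewrite -subr_eq0 -in_qpolyC -rmorphXn -rmorphB /=.
by rewrite in_qpoly_modulus.
Qed.

Lemma radical_sumE x : x = \sum_(i < p) x`_i *: z ^+ i.
Proof.
rewrite -[LHS]in_qpoly_radical -[X in in_qpoly h X]coefK poly_def.
rewrite linear_sum /=.
rewrite (big_ord_widen p (fun i => in_qpoly h (x`_i *: 'X^i))) ?size_radical //.
rewrite [RHS](bigID (fun i : 'I_p => (i < size x)%N)) /=.
rewrite [X in _ = _ + X]big1 ?addr0.
  by apply: eq_bigr => i _; rewrite linearZ rmorphXn.
by move=> i; rewrite -leqNgt => /(nth_default 0)->; rewrite scale0r.
Qed.

Lemma coef_radical_sum (a : nat -> A) j : (j < p)%N ->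
  (\sum_(i < p) a i *: z ^+ i : T)`_j = a j.
Proof.
move=> lt_jp.
have -> : \sum_(i < p) a i *: z ^+ i = in_qpoly h (\poly_(i < p) a i).
  rewrite poly_def linear_sum.
  by apply: eq_bigr => i _; rewrite linearZ rmorphXn.
by rewrite in_qpoly_reduced ?coef_poly ?lt_jp // size_poly.
Qed.

Lemma radicalP x y : (forall i, (i < p)%N -> x`_i = y`_i) -> x = y.
Proof.
move=> xy; rewrite [x]radical_sumE [y]radical_sumE.
by apply: eq_bigr => i _; rewrite xy.
Qed.

Lemma coefZ_radical (a : A) x i : (a *: x)`_i = a * x`_i.
Proof. exact: coefZ. Qed.

Lemma coefD_radical x y i : (x + y)`_i = x`_i + y`_i.
Proof. exact: coefD. Qed.

Lemma coef1_radical : (1 : T)`_0 = 1.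
Proof. by rewrite coefC. Qed.

Lemma poly_of_radicalM x y :
  x * y = Pdiv.CommonRing.rmodp ((x : {poly A}) * y) h :> {poly A}.
Proof.
exact: (congr1 (Pdiv.CommonRing.rmodp ((x : {poly A}) * y)) hE).
Qed.

(** The constant coefficient modulo f is the ring morphism from T to
    T/(z) = A/(f); it is used in this form, without forming the quotient. *)
Lemma coefM0_radical x y : divides f ((x * y)`_0 - x`_0 * y`_0).
Proof.
have hM : h \is monic by exact: monicXnsubC.
have /(congr1 (fun P : {poly A} => P`_0)) :=
  Pdiv.RingMonic.rdivp_eq hM ((x : {poly A}) * y).
rewrite coefD !coef0M coefB coefXn coefC /= (ltn_eqF p_gt0) sub0r => xyE.
set Q := Pdiv.CommonRing.rdivp _ _ in xyE; exists Q`_0; rewrite xyE.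
have -> : (x * y)`_0 = (Pdiv.CommonRing.rmodp ((x : {poly A}) * y) h)`_0.
  by rewrite -poly_of_radicalM.
ring.
Qed.

(** For c^p = 1 the substitution z |-> c z preserves z^p - f. *)
Section Twist.
Variable c : A.
Hypothesis cp : c ^+ p = 1.

Definition twist x : T := in_qpoly h ((x : {poly A}) \Po (c *: 'X)).

Lemma coef_scale_var (P : {poly A}) i : (P \Po (c *: 'X))`_i = c ^+ i * P`_i.
Proof.
elim/poly_ind: P i => [|P d IH] i; first by rewrite comp_poly0 !coef0 mulr0.
rewrite comp_poly_MXaddC -scalerAr !(coefD, coefZ, coefMX, coefC).
case: i => [|i] /=; first by rewrite mulr0 !add0r mul1r.
by rewrite IH !addr0 exprS mulrA.
Qed.

Lemma coef_twist x i : (twist x)`_i = c ^+ i * x`_i.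
Proof.
rewrite /twist in_qpoly_reduced ?coef_scale_var //.
apply/leq_sizeP => j le_pj; rewrite coef_scale_var [x`_j]nth_default ?mulr0 //.
exact: leq_trans (size_radical x) le_pj.
Qed.

Fact twist_zmod_morphism : zmod_morphism twist.
Proof. by move=> x y; rewrite /twist -rmorphB /= -comp_polyB. Qed.

Fact twist_monoid_morphism : monoid_morphism twist.
Proof.
split; first by rewrite /twist comp_polyC in_qpoly1.
move=> x y; rewrite /twist -in_qpolyM -comp_polyM.
have hM : h \is monic by exact: monicXnsubC.
rewrite [in RHS](Pdiv.RingMonic.rdivp_eq hM ((x : {poly A}) * y)).
rewrite comp_polyD [in RHS]comp_polyM rmorphD rmorphM /=.
have -> : h \Po (c *: 'X) = h.
  by rewrite comp_polyB comp_polyC comp_Xn_poly exprZn cp scale1r.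
rewrite in_qpoly_modulus mulr0 add0r.
by congr (in_qpoly h (_ \Po _)); apply: poly_of_radicalM.
Qed.

End Twist.
End RadicalExtension.

(** * Norm and trace *)

(** Cyclic shifts of products over a period; they give the invariance of the
    norm under the Galois action. *)
Lemma prod_shift (R : comNzRingType) n (F : nat -> R) :
  (0 < n)%N -> F n = F 0 -> \prod_(j < n) F j.+1 = \prod_(j < n) F j.
Proof.
by case: n => // n _ FE; rewrite big_ord_recr big_ord_recl /= FE mulrC.
Qed.

Section Norm.

Variables (A : idomainType) (p : nat) (f zeta : A).
Hypothesis zetaP : p.-primitive_root zeta.

Local Notation h := ('X^p - f%:P).
Local Notation T := {poly %/ h}.
Local Notation z := ('qX : T).
Implicit Types x y : T.

Let p_gt0 : (0 < p)%N := prim_order_gt0 zetaP.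

Lemma zetaX_order j : (zeta ^+ j) ^+ p = 1.
Proof. by rewrite exprAC (prim_expr_order zetaP) expr1n. Qed.

Lemma prim_root_unit j : zeta ^+ j \is a GRing.unit.
Proof.
by apply: unitrX; rewrite -(unitrX_pos _ p_gt0) (prim_expr_order zetaP) unitr1.
Qed.

Definition gal j x : T := twist (zeta ^+ j) x.

HB.instance Definition _ j := GRing.isZmodMorphism.Build T T (gal j)
  (@twist_zmod_morphism A p f (zeta ^+ j)).
HB.instance Definition _ j := GRing.isMonoidMorphism.Build T T (gal j)
  (twist_monoid_morphism f p_gt0 (zetaX_order j)).

Lemma coef_gal j x i : (gal j x)`_i = zeta ^+ (j * i) * x`_i.
Proof. by rewrite coef_twist // exprM. Qed.

Lemma gal_gal i j x : gal i (gal j x) = gal (i + j) x.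
Proof.
apply: (radicalP p_gt0) => l _.
by rewrite !coef_gal mulrA -exprD mulnDl.
Qed.

Lemma gal0 x : gal 0 x = x.
Proof. by apply: (radicalP p_gt0) => l _; rewrite coef_gal mul0n mul1r. Qed.

Lemma gal_order x : gal p x = x.
Proof.
apply: (radicalP p_gt0) => l _.
by rewrite coef_gal exprM (prim_expr_order zetaP) expr1n mul1r.
Qed.

Lemma galZ j a x : gal j (a *: x) = a *: gal j x.
Proof.
apply: (radicalP p_gt0) => l _.
by rewrite coef_gal !coefZ_radical coef_gal mulrCA.
Qed.

Lemma galM j x y : gal j (x * y) = gal j x * gal j y.
Proof. exact: rmorphM. Qed.

Lemma gal_prod j I (r : seq I) (F : I -> T) :
  gal j (\prod_(i <- r) F i) = \prod_(i <- r) gal j (F i).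
Proof. exact: rmorph_prod. Qed.

Lemma gal_sum j I (r : seq I) (F : I -> T) :
  gal j (\sum_(i <- r) F i) = \sum_(i <- r) gal j (F i).
Proof. exact: rmorph_sum. Qed.

Lemma prod_gal_shift x : \prod_(j < p) gal j.+1 x = \prod_(j < p) gal j x.
Proof.
by apply: (prod_shift (F := fun j => gal j x)); rewrite ?gal_order ?gal0.
Qed.

(** The coefficient of z^i is multiplied by zeta^i, and zeta^i is not 1 for
    0 < i < p. *)
Lemma gal_fixed x : gal 1 x = x -> x = (x`_0)%:A.
Proof.
move=> xE; apply: (radicalP p_gt0) => -[|i] lt_ip.
  by rewrite coefZ_radical coef1_radical mulr1.
have /(congr1 (fun y : T => y`_i.+1)) := xE.
rewrite coef_gal mul1n coefZ_radical [(1 : T)`_i.+1]coefC mulr0 => /eqP.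
rewrite -subr_eq0 -{2}[x`_i.+1]mul1r -mulrBl mulf_eq0 subr_eq0.
by rewrite -(prim_order_dvd zetaP) gtnNdvd //= => /eqP.
Qed.

(** The product of the conjugates is invariant, hence a constant polynomial in
    z ([prod_gal]); the norm is that constant. *)
Definition norm x : A := (\prod_(j < p) gal j x)`_0.

Lemma prod_gal x : \prod_(j < p) gal j x = (norm x)%:A.
Proof.
apply: gal_fixed; rewrite rmorph_prod /= -[RHS]prod_gal_shift.
by apply: eq_bigr => j _; rewrite gal_gal add1n.
Qed.

Lemma alg_coef0 (a : A) : (a%:A : T)`_0 = a.
Proof. by rewrite coefZ_radical coef1_radical mulr1. Qed.

Lemma alg_radical_inj (a b : A) : a%:A = b%:A :> T -> a = b.
Proof. by move=> /(congr1 (fun y : T => y`_0)); rewrite !alg_coef0. Qed.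

Lemma normM x y : norm (x * y) = norm x * norm y.
Proof.
apply: alg_radical_inj.
rewrite -prod_gal (eq_bigr (fun j : 'I_p => gal j x * gal j y)).
  by rewrite big_split /= !prod_gal -scalerAl mul1r scalerA.
by move=> j _; rewrite rmorphM.
Qed.

Lemma normZ a x : norm (a *: x) = a ^+ p * norm x.
Proof.
apply: alg_radical_inj.
rewrite -prod_gal (eq_bigr (fun j : 'I_p => a *: gal j x)).
  rewrite scaler_prod prodr_const card_ord prod_gal scalerA //.
by move=> j _; rewrite galZ.
Qed.

Lemma norm1 : norm 1 = 1.
Proof. by rewrite /norm big1 ?coef1_radical // => j _; rewrite rmorph1. Qed.

Lemma norm_gal x : norm (gal 1 x) = norm x.
Proof.
apply: alg_radical_inj; rewrite -!prod_gal -[RHS]prod_gal_shift.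
by apply: eq_bigr => j _; rewrite gal_gal addn1.
Qed.

Lemma norm_galn j x : norm (gal j x) = norm x.
Proof.
elim: j => [|j IH]; first by rewrite gal0.
by rewrite -add1n -gal_gal norm_gal.
Qed.

Lemma coef_prod0 n (F : 'I_n -> T) :
  divides f ((\prod_i F i)`_0 - \prod_i (F i)`_0).
Proof.
elim: n F => [|n IH] F.
  by rewrite !big_ord0 coef1_radical subrr; apply: divides0.
rewrite !big_ord_recl; set P := \prod_(i < n) _; set Q := \prod_(i < n) _.
have -> : (F ord0 * P)`_0 - (F ord0)`_0 * Q =
  ((F ord0 * P)`_0 - (F ord0)`_0 * P`_0) + (F ord0)`_0 * (P`_0 - Q) by ring.
apply: dividesD; first exact: coefM0_radical.
exact/dividesMl/IH.
Qed.

Lemma norm_mod x : divides f (norm x - x`_0 ^+ p).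
Proof.
have := @coef_prod0 p (fun j : 'I_p => gal j x).
rewrite (eq_bigr (fun=> x`_0)) ?prodr_const ?card_ord //.
by move=> j _; rewrite coef_gal muln0 mul1r.
Qed.

Lemma sum_prim_root_exp l : ~~ (p %| l)%N -> \sum_(j < p) zeta ^+ (j * l) = 0.
Proof.
rewrite (prim_order_dvd zetaP) -subr_eq0 => zl.
apply: (mulfI zl); rewrite mulr0.
under eq_bigr do rewrite mulnC exprM.
by rewrite -subrX1 zetaX_order subrr.
Qed.

(** Projection onto the isotypic component of z^i.  The exponent p - i stands
    for - i, as zeta has order p. *)
Lemma trace_gal x i : (i < p)%N ->
  \sum_(j < p) zeta ^+ (j * (p - i)) *: gal j x = (p%:R * x`_i) *: z ^+ i.
Proof.
move=> lt_ip.
pose a l : A := if l == i then p%:R * x`_i else 0.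
have -> : (p%:R * x`_i) *: z ^+ i = \sum_(l < p) a l *: z ^+ l.
  rewrite (bigD1 (Ordinal lt_ip)) //= /a eqxx big1 ?addr0 // => l ne_li.
  by rewrite -(inj_eq val_inj) /= in ne_li; rewrite (negPf ne_li) scale0r.
apply: (radicalP p_gt0) => l lt_lp; rewrite coef_radical_sum // /a.
rewrite coefn_sum (eq_bigr (fun j : 'I_p => zeta ^+ (j * (p - i + l)) * x`_l)).
  rewrite -mulr_suml; case: eqP => [->|ne_li].
    rewrite subnK ?(ltnW lt_ip) //; congr (_ * _).
    rewrite (eq_bigr (fun=> 1)) ?sumr_const ?card_ord // => j _.
    by rewrite mulnC exprM (prim_expr_order zetaP) expr1n.
  rewrite sum_prim_root_exp ?mul0r //; apply/negP => /dvdnP[e eE].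
  by case: e eE => [|[|e]]; lia.
by move=> j _; rewrite coefZ_radical coef_gal mulrA -exprD mulnDr.
Qed.

Hypothesis p_gt1 : (1 < p)%N.

(** The unit is the product of all the p-th roots of unity, that is, plus or
    minus 1. *)
Lemma norm_radical : exists2 e, e \is a GRing.unit & norm z = e * f.
Proof.
exists (\prod_(j < p) zeta ^+ j).
  by apply: rpred_prod => j _; apply: prim_root_unit.
apply: alg_radical_inj.
rewrite -prod_gal (eq_bigr (fun j : 'I_p => zeta ^+ j *: z)).
  by rewrite scaler_prod prodr_const card_ord radicalX // scalerA.
have zi i : (z : {poly A})`_i = (i == 1)%:R.
  by rewrite in_qpoly_reduced ?size_polyX // coefX.
move=> j _; apply: (radicalP p_gt0) => i _; rewrite coef_gal coefZ_radical zi.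
by case: eqP => [->|_]; rewrite ?muln1 // !mulr0.
Qed.

End Norm.

(** * Roots of unity and binomial coefficients modulo a prime *)

Lemma closed_exp_root (k : closedFieldType) p (c : k) :
  (0 < p)%N -> exists a, a ^+ p = c.
Proof.
move=> p_gt0; have /closed_rootP[a] : size ('X^p - c%:P) != 1.
  by rewrite size_XnsubC // eqSS -lt0n.
by rewrite rootE !hornerE subr_eq0 => /eqP; exists a.
Qed.

(** A root of 1 + X + .. + X^(p-1) is a p-th root of unity, and it is not 1
    since the value at 1 is p. *)
Lemma closed_prim_root (k : closedFieldType) p :
  prime p -> (p%:R : k) != 0 -> exists zeta : k, p.-primitive_root zeta.
Proof.
move=> p_pr p0; have p_gt1 := prime_gt1 p_pr.
pose P : {poly k} := \poly_(i < p) 1.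
have /closed_rootP[x] : size P != 1.
  by rewrite size_poly_eq ?oner_eq0 // neq_ltn p_gt1 orbT.
rewrite rootE horner_poly => /eqP Px.
have x1 : x != 1.
  apply: contraNneq p0 => x1; rewrite -Px x1.
  rewrite (eq_bigr (fun=> 1)) ?sumr_const ?card_ord // => i _.
  by rewrite mul1r expr1n.
have xp : x ^+ p = 1.
  apply/eqP; rewrite -subr_eq0 subrX1 (eq_bigr (fun i : 'I_p => 1 * x ^+ i)).
    by rewrite Px mulr0.
  by move=> i _; rewrite mul1r.
have [l lP] := prim_order_exists (prime_gt0 p_pr) xp.
case/primeP: (p_pr) => _ /[apply] /orP[] /eqP lE; last by exists x; rewrite -lE.
move: lP x1; rewrite lE => /prim_expr_order; rewrite expr1 => ->.
by rewrite eqxx.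
Qed.

Lemma prod_first (R : comNzRingType) n (F : nat -> R) :
  (0 < n)%N -> \prod_(j < n) F j = F 0 * \prod_(j < n.-1) F j.+1.
Proof. by case: n => // n _; rewrite big_ord_recl. Qed.

Lemma sum_shift (V : zmodType) n (F : nat -> V) :
  (0 < n)%N -> F n = F 0 -> \sum_(j < n) F j.+1 = \sum_(j < n) F j.
Proof.
by case: n => // n _ FE; rewrite big_ord_recr big_ord_recl /= FE addrC.
Qed.

(** (1 - X)^(p-1) = 1 + X + .. + X^(p-1) modulo p, coefficient by coefficient;
    the signs are moved so as to have an identity between natural numbers. *)
Lemma bin_pred_prime p i : prime p -> (i < p)%N ->
  exists e, ('C(p.-1, i) + odd i = ~~ odd i + p * e)%N.
Proof.
move=> p_pr; have p_gt0 := prime_gt0 p_pr; elim: i => [|i IH] lt_ip.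
  by exists 0%N; rewrite bin0 muln0.
have [e eE] := IH (ltnW lt_ip).
have /dvdnP[b bE] : (p %| 'C(p, i.+1))%N by apply: prime_dvd_bin.
have {bE} : ('C(p.-1, i.+1) + 'C(p.-1, i) = b * p)%N by rewrite -binS prednK.
exists (b - e)%N; rewrite mulnBr [(p * b)%N]mulnC.
have p_gt1 := prime_gt1 p_pr; have le_eb : (p * e <= b * p)%N.
  rewrite [(b * p)%N]mulnC leq_pmul2l // leqNgt; apply/negP => lt_be.
  have := leq_mul (leqnn p) lt_be; rewrite mulnS [(p * b)%N]mulnC.
  by move: eE; case: (odd i) => /=; lia.
by move: eE; rewrite /=; case: (odd i) => /=; lia.
Qed.

(** * Units of radical extensions *)
Section Units.

(** A is a factorial domain whose additive degree function vanishes exactly on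
    the constants. *)
Variables (k : closedFieldType) (A : idomainType) (cst : {rmorphism k -> A}).
Variable deg : A -> nat.
Hypothesis degM : forall a b,
  a != 0 -> b != 0 -> deg (a * b) = (deg a + deg b)%N.
Hypothesis deg_cst : forall c, deg (cst c) = 0.
Hypothesis deg0_cst : forall a, deg a = 0 -> exists c, a = cst c.
Hypothesis ufdA : irreducible_is_prime A.

Lemma unit_constP (a : A) :
  a \is a GRing.unit <-> exists2 c, c != 0 & a = cst c.
Proof.
split=> [aU|[c c0 ->]]; last by rewrite rmorph_unit // unitfE.
have a0 : a != 0 by apply: contraTneq aU => ->; rewrite unitr0.
have [|c aE] := @deg0_cst a; last first.
  by exists c => //; apply: contraNneq a0 => c0; rewrite aE c0 rmorph0.
have V0 : a^-1 != 0 by rewrite invr_eq0.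
have := degM a0 V0; rewrite divrr // -(rmorph1 cst) deg_cst => /esym/eqP.
by rewrite addn_eq0 => /andP[/eqP].
Qed.

Lemma deg_lt (a b : A) :
  a != 0 -> b != 0 -> b \isn't a GRing.unit -> (deg a < deg (a * b))%N.
Proof.
move=> a0 b0 bN; rewrite degM // -[ltnLHS]addn0 ltn_add2l lt0n.
apply: contra bN => /eqP/deg0_cst[c bE]; apply/unit_constP; exists c => //.
by apply: contraNneq b0 => c0; rewrite bE c0 rmorph0.
Qed.

Variables (f : A) (p : nat) (zeta : k).
Hypothesis f_irr : irreducible_elt f.
Hypothesis p_pr : prime p.
Hypothesis p_neq0 : (p%:R : k) != 0.
Hypothesis zetaP : p.-primitive_root zeta.

Local Notation h := ('X^p - f%:P).
Local Notation T := {poly %/ h}.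
Local Notation z := ('qX : T).
Local Notation gal := (@gal A p f (cst zeta)).
Local Notation norm := (@norm A p f (cst zeta)).
Implicit Types (x y u v w : T) (c : k).

Let p_gt0 : (0 < p)%N := prime_gt0 p_pr.
Let p_gt1 : (1 < p)%N := prime_gt1 p_pr.
Let f_prime : prime_elt f := ufdA f_irr.

Let zP : p.-primitive_root (cst zeta).
Proof. by rewrite fmorph_primitive_root. Qed.

(* Specialisations of the previous results to the root of unity cst zeta. *)
Let NM := @normM A p f _ zP.
Let NZ := @normZ A p f _ zP.
Let N1 := @norm1 A p f _ zP.
Let NJ := @norm_galn A p f _ zP.
Let JJ := @gal_gal A p f _ zP.
Let J0 := @gal0 A p f _ zP.
Let CJ := @coef_gal A p f _ zP.

Lemma cst_unit c : c != 0 -> cst c \is a GRing.unit.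
Proof. by move=> c0; apply/unit_constP; exists c. Qed.

Lemma f_ndivides_const c : c != 0 -> ~ divides f (cst c).
Proof.
move=> c0 /divides_unit/(_ (cst_unit c0)).
by case: f_irr => _ /negPf->.
Qed.

Lemma divides_exp_sub1 (a : A) :
  divides f (a ^+ p - 1) -> exists i, divides f (a - cst (zeta ^+ i)).
Proof.
have -> : a ^+ p - 1 = \prod_(i < p) (a - cst (zeta ^+ i)).
  have := congr1 (map_poly cst) (factor_Xn_sub_1 zetaP).
  rewrite big_mkord rmorph_prod rmorphB /= map_polyXn rmorph1.
  move/(congr1 (horner^~ a)).
  rewrite horner_prod hornerD hornerN hornerXn hornerC => <-.
  by apply: eq_bigr => i _; rewrite map_polyXsubC hornerXsubC.
by move=> /(prime_divides_prod f_prime)[i fi]; exists i.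
Qed.

(** In the domain A/(f) the only p-th roots of a nonzero constant are
    constants, as k already contains p of them. *)
Lemma residue_root (a : A) c :
  c != 0 -> divides f (a ^+ p - cst c) ->
  exists2 g : k, g ^+ p = c & divides f (a - cst g).
Proof.
move=> c0 fa; have [g gE] := closed_exp_root c p_gt0.
have g0 : g != 0.
  by apply: contraNneq c0 => g0; rewrite -gE g0 expr0n eqn0Ngt p_gt0.
have [|i fi] := @divides_exp_sub1 (cst (g^-1) * a).
  have -> : (cst (g^-1) * a) ^+ p - 1 = cst (c^-1) * (a ^+ p - cst c).
    by rewrite exprMn mulrBr -rmorphM mulVf // rmorph1 -rmorphXn exprVn gE.
  exact: dividesMl.
exists (g * zeta ^+ i).
  by rewrite exprMn gE exprAC (prim_expr_order zetaP) expr1n mulr1.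
have -> : a - cst (g * zeta ^+ i) = cst g * (cst (g^-1) * a - cst (zeta ^+ i)).
  by rewrite mulrBr mulrA -!rmorphM divff // rmorph1 mul1r.
exact: dividesMl.
Qed.

(** ** Principal units *)

(** Units of norm 1 that are 1 on the ramification divisor z = 0. *)
Definition principal_unit u := norm u = 1 /\ divides f (u`_0 - 1).

Lemma norm_unit x : is_unit x -> norm x \is a GRing.unit.
Proof.
move=> [y yx]; apply/unitrP; exists (norm y); split.
  by rewrite -NM yx N1.
by rewrite mulrC -NM yx N1.
Qed.

Lemma unit_scale x : is_unit x ->
  exists g u, [/\ g != 0, principal_unit u & x = cst g *: u].
Proof.
move=> xU; have [c c0 nx] := (unit_constP _).1 (norm_unit xU).
have fx : divides f (x`_0 ^+ p - cst c).
  have /dividesN := norm_mod zP x; rewrite opprB nx; exact.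
have [g gE fg] := residue_root c0 fx.
have g0 : g != 0.
  by apply: contraNneq c0 => g0; rewrite -gE g0 expr0n eqn0Ngt p_gt0.
exists g, (cst (g^-1) *: x); split=> //; last first.
  by rewrite scalerA -rmorphM divff // rmorph1 scale1r.
split; first by rewrite NZ nx -rmorphXn -rmorphM exprVn gE mulVf // rmorph1.
have -> : (cst (g^-1) *: x)`_0 - 1 = cst (g^-1) * (x`_0 - cst g).
  by rewrite coefZ_radical mulrBr -rmorphM mulVf // rmorph1.
exact: dividesMl.
Qed.

Lemma principal_unitM u v :
  principal_unit u -> principal_unit v -> principal_unit (u * v).
Proof.
move=> [nu fu] [nv fv]; split; first by rewrite NM nu nv mulr1.
have -> : (u * v)`_0 - 1 = ((u * v)`_0 - u`_0 * v`_0) +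
  (u`_0 * (v`_0 - 1) + (u`_0 - 1)) by ring.
apply: dividesD; first exact: coefM0_radical.
by apply: dividesD => //; apply: dividesMl.
Qed.

Lemma principal_unit1 : principal_unit 1.
Proof.
by split; rewrite ?N1 // coef1_radical subrr; apply: divides0.
Qed.

Lemma principal_unit_prod I (r : seq I) (P : pred I) (F : I -> T) :
  (forall i, P i -> principal_unit (F i)) ->
  principal_unit (\prod_(i <- r | P i) F i).
Proof.
move=> PF; elim/big_ind: _ => //; first exact: principal_unit1.
exact: principal_unitM.
Qed.

Lemma principal_unitX u n : principal_unit u -> principal_unit (u ^+ n).
Proof.
move=> Pu; elim: n => [|n IH]; first exact: principal_unit1.
by rewrite exprS; apply: principal_unitM.
Qed.

Lemma principal_unit_gal j u : principal_unit u -> principal_unit (gal j u).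
Proof.
move=> [nu fu]; split; first by rewrite NJ.
by rewrite CJ muln0 mul1r.
Qed.

(** As the norm is 1, the inverse is the product of the other conjugates. *)
Lemma principal_unitV u : principal_unit u ->
  exists2 v, principal_unit v & u * v = 1.
Proof.
move=> Pu; exists (\prod_(j < p.-1) gal j.+1 u).
  by apply: principal_unit_prod => j _; apply: principal_unit_gal.
rewrite -{1}[u]J0 -(prod_first (fun j => gal j u)) //.
by rewrite prod_gal // Pu.1 scale1r.
Qed.

(** ** Divisibility by 1 - s *)

Definition partial_norm u i : T := \prod_(j < i) gal j u.

Lemma principal_unit_partial_norm u i :
  principal_unit u -> principal_unit (partial_norm u i).
Proof.
by move=> Pu; apply: principal_unit_prod => j _; apply: principal_unit_gal.
Qed.

(** Hilbert's Theorem 90, with the resolvent of the element 1.  It is nonzero,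
    and even prime to z, because each partial norm is 1 modulo z and p is
    invertible. *)
Lemma hilbert90_solution u : principal_unit u ->
  exists2 v, u * gal 1 v = v & ~ divides f (norm v).
Proof.
move=> Pu; exists (\sum_(i < p) partial_norm u i).
  rewrite (gal_sum zP) mulr_sumr -[RHS](sum_shift (F := partial_norm u)) //.
    apply: eq_bigr => i _; rewrite /partial_norm big_ord_recl J0 (gal_prod zP).
    by congr (_ * _); apply: eq_bigr => j _; rewrite JJ add1n.
  by rewrite /partial_norm big_ord0 (prod_gal zP) Pu.1 scale1r.
set v := \sum_(i < p) _ => fv.
have fv0 : divides f (v`_0).
  apply: (prime_divides_exp f_prime (n := p)).
  rewrite -[_ ^+ p](subKr (norm v)); apply: dividesB => //; exact: norm_mod.
have fvp : divides f (v`_0 - p%:R).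
  have -> : v`_0 - p%:R = \sum_(i < p) ((partial_norm u i)`_0 - 1).
    by rewrite /v coefn_sum sumrB sumr_const card_ord.
  apply: divides_sum => i _; exact: (principal_unit_partial_norm i Pu).2.
apply: (f_ndivides_const p_neq0); rewrite rmorph_nat -(subKr v`_0 p%:R).
exact: dividesB.
Qed.

Lemma norm_exp x n : norm (x ^+ n) = norm x ^+ n.
Proof. by elim: n => [|n IH]; rewrite ?N1 // !exprS NM IH. Qed.

(** v is associated with all its conjugates, so v divides its isotypic
    components p v_i z^i.  Taking norms, N(v) divides (p v_i)^p (N z)^i, where
    N z is f up to a unit, and q is prime to p and to f. *)
Lemma prime_divides_coef u v q : principal_unit u -> u * gal 1 v = v ->
  ~ divides f (norm v) -> irreducible_elt q -> divides q (norm v) ->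
  forall i : 'I_p, divides q v`_i.
Proof.
move=> Pu uv fv q_irr qv i; have q_pr := ufdA q_irr.
have [u' _ uu'] := principal_unitV Pu.
have vJ j : exists b, gal j v = b * v.
  elim: j => [|j [b IH]]; first by exists 1; rewrite J0 mul1r.
  exists (gal j u' * b); rewrite -addn1 -JJ -mulrA -IH -(galM zP).
  by congr (gal j _); rewrite -[in RHS]uv mulrA [u' * u]mulrC uu' mul1r.
have [t tE] : exists t, (p%:R * v`_i) *: z ^+ i = t * v.
  rewrite -(trace_gal zP) //; elim/big_rec: _ => [|j _ _ [t ->]].
    by exists 0; rewrite mul0r.
  have [b ->] := vJ j; exists ((cst zeta) ^+ (j * (p - i)) *: b + t).
  by rewrite mulrDl scalerAl.
have [e eU nz] := norm_radical f zP p_gt1.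
have : divides q ((p%:R * v`_i) ^+ p * (e * f) ^+ i).
  have /(congr1 norm) := tE; rewrite NZ norm_exp nz NM => ->.
  exact: dividesMl.
case/q_pr.2 => /(prime_divides_exp q_pr)/q_pr.2[] //.
- rewrite -(rmorph_nat cst) => /divides_unit/(_ (cst_unit p_neq0)).
  by case: q_irr => _ /negPf->.
- by move=> /divides_unit/(_ eU); case: q_irr => _ /negPf->.
move=> qf; case: fv; apply: divides_trans qv.
by apply: divides_irreducible qf => //; case: q_irr.
Qed.

Lemma unit_of_norm v : norm v \is a GRing.unit -> is_unit v.
Proof.
move=> nU; exists ((norm v)^-1 *: \prod_(j < p.-1) gal j.+1 v).
rewrite -scalerAl mulrC -[X in X * _]J0 -(prod_first (fun j => gal j v)) //.
by rewrite prod_gal // scalerA mulVr // scale1r.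
Qed.

(** Induction on the degree of N(v), dividing v by the prime factors of N(v). *)
Lemma hilbert90_unit u v : principal_unit u -> u * gal 1 v = v ->
  ~ divides f (norm v) -> exists2 v', is_unit v' & u * gal 1 v' = v'.
Proof.
move=> Pu; have [n] := ubnP (deg (norm v)); elim: n v => // n IH v le_vn uv fv.
have [nU|nN] := boolP (norm v \is a GRing.unit).
  by exists v => //; apply: unit_of_norm.
have nv0 : norm v != 0.
  by apply/eqP => nv0; apply: fv; rewrite nv0; apply: divides0.
have [q q_irr qv] := irreducible_factor deg_lt nv0 nN.
have [d dE] := fin_all_exists (prime_divides_coef Pu uv fv q_irr qv).
pose w : T := \sum_(i < p) d i *: z ^+ i.
have vE : v = q *: w.
  rewrite [LHS]radical_sumE // scaler_sumr; apply: eq_bigr => i _.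
  by rewrite dE scalerA mulrC.
have [q0 qN _] := q_irr.
have nvE : norm v = norm w * q ^+ p by rewrite vE NZ mulrC.
have nw0 : norm w != 0 by apply: contraNneq nv0 => nw0; rewrite nvE nw0 mul0r.
apply: (IH w).
- rewrite -ltnS (leq_trans _ le_vn) // ltnS nvE deg_lt ?expf_neq0 //.
  by rewrite unitrX_pos.
- apply: (radicalP p_gt0) => i _; apply: (mulfI q0).
  have /(congr1 (fun y : T => y`_i)) := uv.
  by rewrite vE galZ // -scalerAr !coefZ_radical.
by move=> fw; apply: fv; rewrite nvE; apply: dividesMr.
Qed.

(** H^1 of the Galois group vanishes on principal units. *)
Theorem hilbert90 u : principal_unit u ->
  exists2 v, principal_unit v & u * gal 1 v = v.
Proof.
move=> Pu; have [v uv fv] := hilbert90_solution Pu.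
have [w wU uw] := hilbert90_unit Pu uv fv.
have [g [v' [g0 Pv' wE]]] := unit_scale wU.
exists v' => //; move: uw; rewrite wE galZ // -scalerAr.
move/(congr1 ( *:%R (cst g^-1))).
by rewrite !scalerA -rmorphM mulVf // rmorph1 !scale1r.
Qed.

(** ** Divisibility by p *)

(** In additive notation (1 - s)^n y is [diff_part false n y] minus
    [diff_part true n y]: the terms of even and of odd degree of the binomial
    expansion. *)
Definition diff_part (b : bool) n y : T :=
  \prod_(i < n.+1) gal i y ^+ ('C(n, i) * (odd i == b)).

Lemma diff_partM b n x y :
  diff_part b n (x * y) = diff_part b n x * diff_part b n y.
Proof.
rewrite -big_split; apply: eq_bigr => i _.
by rewrite (galM zP) exprMn.
Qed.

(** Pascal's rule, that is (1 - s)^(n+1) = (1 - s)^n - s (1 - s)^n. *)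
Lemma diff_partS b n y :
  diff_part b n.+1 y = diff_part b n y * diff_part (~~ b) n (gal 1 y).
Proof.
have -> : diff_part b n y =
    \prod_(i < n.+2) gal i y ^+ ('C(n, i) * (odd i == b)).
  by rewrite big_ord_recr /= bin_small // mul0n expr0 mulr1.
rewrite /diff_part !(big_ord_recl n.+1) /= !bin0 -mulrA; congr (_ * _).
rewrite -big_split; apply: eq_bigr => i _ /=.
rewrite JJ addn1 -exprD binS mulnDl; congr (_ ^+ (_ + _ * _)).
by case: (odd i); case: b.
Qed.

Lemma iterated_hilbert90 n u : principal_unit u ->
  exists2 y, principal_unit y & u * diff_part true n y = diff_part false n y.
Proof.
move=> Pu; elim: n => [|n [y Py uy]].
  by exists u => //; rewrite /diff_part !big_ord1 /= expr0 mulr1 expr1 J0.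
have [w Pw yw] := hilbert90 Py; exists w => //.
have E b : diff_part b n w = diff_part b n y * diff_part b n (gal 1 w).
  by rewrite -diff_partM yw.
rewrite !diff_partS /= (E true) (E false) -uy; ring.
Qed.

(** u = (1 - s)^(p-1) y, and (1 - s)^(p-1) y = N(y) = 1 up to p-th powers by
    [bin_pred_prime]. *)
Lemma principal_unit_pth_power u : principal_unit u ->
  exists2 w, principal_unit w & u = w ^+ p.
Proof.
move=> Pu; have [y Py uy] := iterated_hilbert90 p.-1 Pu.
have [e eE] := fin_all_exists (fun i : 'I_p => bin_pred_prime p_pr (ltn_ord i)).
pose W b : T := \prod_(i < p) gal i y ^+ ((odd i == b) * e i).
have PW b : principal_unit (W b).
  apply: principal_unit_prod => i _.
  exact/principal_unitX/principal_unit_gal.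
have dE b : diff_part b p.-1 y =
    \prod_(i < p) gal i y ^+ ('C(p.-1, i) * (odd i == b)).
  by rewrite /diff_part prednK.
have uW : u * W true ^+ p = W false ^+ p.
  (* Multiplying both sides by the conjugates of odd index turns every
     exponent into a multiple of p, up to one factor N(y) = 1. *)
  pose O : T := \prod_(i < p) gal i y ^+ odd i.
  have WX b : W b ^+ p = \prod_(i < p) gal i y ^+ ((odd i == b) * e i * p).
    by rewrite -prodrXl; apply: eq_bigr => i _; rewrite -exprM.
  have <- : diff_part true p.-1 y * O = W true ^+ p.
    rewrite dE WX -big_split; apply: eq_bigr => i _ /=.
    rewrite -exprD; congr (_ ^+ _); have := eE i.
    by case: (odd i) => /= ?; nia.
  have <- : diff_part false p.-1 y * O = W false ^+ p.
    have y1 : \prod_(i < p) gal i y = 1 by rewrite (prod_gal zP) Py.1 scale1r.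
    rewrite dE WX -[RHS]mul1r -[X in _ = X * _]y1 -!big_split.
    apply: eq_bigr => i _ /=.
    rewrite -exprD -exprS; congr (_ ^+ _); have := eE i.
    by case: (odd i) => /= ?; nia.
  by rewrite mulrA uy.
have [v Pv wv] := principal_unitV (PW true).
exists (W false * v); first exact: principal_unitM.
by rewrite exprMn -uW -mulrA -exprMn wv expr1n mulr1.
Qed.

(** ** The degree filtration *)

Hypothesis degD : forall a b, (deg (a + b) <= maxn (deg a) (deg b))%N.

Let f0 : f != 0. Proof. by case: f_irr. Qed.

Lemma deg_f_gt0 : (0 < deg f)%N.
Proof.
rewrite lt0n; apply/eqP => /deg0_cst[c fE].
have := f_irr => -[_ /negP[]]; rewrite fE; apply: cst_unit.
by apply: contraNneq f0 => c0; rewrite fE c0 rmorph0.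
Qed.

Lemma degX a n : a != 0 -> deg (a ^+ n) = (n * deg a)%N.
Proof.
move=> a0; elim: n => [|n IH]; first by rewrite expr0 -(rmorph1 cst) deg_cst.
by rewrite exprS degM ?expf_neq0 // IH mulSn.
Qed.

(** The degree on T for which z has degree deg(f)/p, scaled by p to be an
    integer. *)
Definition weight_le e x : Prop :=
  forall i : 'I_p, x`_i != 0 -> (p * deg x`_i + i * deg f <= e)%N.

Lemma weight_le_mono e e' x : (e <= e')%N -> weight_le e x -> weight_le e' x.
Proof. by move=> le_ee' xe i /xe/leq_trans; apply. Qed.

Lemma weight_le0 e : weight_le e 0.
Proof. by move=> i; rewrite coef0 eqxx. Qed.

Lemma weight_leD e x y : weight_le e x -> weight_le e y -> weight_le e (x + y).
Proof.
move=> xe ye i; rewrite coefD_radical.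
have [->|x0] := eqVneq x`_i 0; first by rewrite add0r; apply: ye.
have [->|y0 _] := eqVneq y`_i 0; first by rewrite addr0 => _; apply: xe.
have := degD x`_i y`_i; have := xe _ x0; have := ye _ y0.
rewrite leq_max => le_y le_x /orP[] le_d.
  by apply: leq_trans le_x; rewrite leq_add2r leq_mul2l le_d orbT.
by apply: leq_trans le_y; rewrite leq_add2r leq_mul2l le_d orbT.
Qed.

Lemma weight_le_sum e I (r : seq I) (P : pred I) (F : I -> T) :
  (forall i, P i -> weight_le e (F i)) -> weight_le e (\sum_(i <- r | P i) F i).
Proof.
move=> Fe; elim/big_ind: _ => //; [exact: weight_le0 | exact: weight_leD].
Qed.

Lemma weight_leMn e x n : weight_le e x -> weight_le e (x *+ n).
Proof.
move=> xe; elim: n => [|n IH]; first exact: weight_le0.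
by rewrite mulrS; apply: weight_leD.
Qed.

Lemma coef_monomial (a : A) i j : (i < p)%N -> (j < p)%N ->
  (a *: z ^+ i : T)`_j = if j == i then a else 0.
Proof.
move=> lt_ip lt_jp.
rewrite -(coef_radical_sum f p_gt0 (fun j => if j == i then a else 0)) //.
congr (_`_ _); rewrite (bigD1 (Ordinal lt_ip)) //= eqxx big1 ?addr0 // => l.
by rewrite -(inj_eq val_inj) /= => /negPf->; rewrite scale0r.
Qed.

(** For i >= p the reduction z^p = f preserves the weight. *)
Lemma weight_le_monomial e (a : A) i :
  (p * deg a + i * deg f <= e)%N -> weight_le e (a *: z ^+ i).
Proof.
have [->|] := eqVneq a 0; first by rewrite scale0r => _; apply: weight_le0.
elim/ltn_ind: i a => i IH a a0 le_e.
have [lt_ip|le_pi] := ltnP i p.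
  move=> j; rewrite coef_monomial //.
  by case: (eqVneq (j : nat) i) => [->|]; rewrite ?eqxx.
rewrite -(subnK le_pi) exprD radicalX // -scalerAr mulr1 scalerA.
apply: IH; rewrite ?mulf_neq0 ?degM // ?ltn_subrL ?p_gt0 ?(leq_trans p_gt0) //.
apply: leq_trans le_e; rewrite mulnDr -addnA leq_add2l -mulnDl.
by rewrite addnC subnK.
Qed.

Lemma weight_leM e e' x y :
  weight_le e x -> weight_le e' y -> weight_le (e + e') (x * y).
Proof.
move=> xe ye; rewrite [x]radical_sumE // [y]radical_sumE //.
rewrite mulr_suml; apply: weight_le_sum => i _.
rewrite mulr_sumr; apply: weight_le_sum => j _.
rewrite -scalerAl -scalerAr scalerA -exprD.
have [->|x0] := eqVneq x`_i 0.
  by rewrite mul0r scale0r; apply: weight_le0.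
have [->|y0] := eqVneq y`_j 0.
  by rewrite mulr0 scale0r; apply: weight_le0.
apply: weight_le_monomial; rewrite degM //.
by rewrite mulnDr mulnDl addnACA leq_add ?xe ?ye.
Qed.

Lemma weight_le1 : weight_le 0 1.
Proof.
rewrite -(scale1r 1) -(expr0 z); apply: weight_le_monomial.
by rewrite -(rmorph1 cst) deg_cst muln0.
Qed.

Lemma weight_leX n e x : weight_le e x -> weight_le (n * e) (x ^+ n).
Proof.
move=> xe; elim: n => [|n IH]; first exact: weight_le1.
by rewrite exprS mulSn; apply: weight_leM.
Qed.

Lemma weight_le_scale e c x : weight_le e x -> weight_le e (cst c *: x).
Proof.
have [->|c0] := eqVneq c 0.
  by rewrite rmorph0 scale0r => _; apply: weight_le0.
move=> xe i; rewrite coefZ_radical mulf_eq0 fmorph_eq0 (negPf c0) /= => x0.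
by rewrite degM ?fmorph_eq0 // deg_cst add0n xe.
Qed.

Lemma weight_le_gal e j x : weight_le e x -> weight_le e (gal j x).
Proof.
move=> xe i; rewrite CJ -rmorphXn -coefZ_radical.
exact: weight_le_scale.
Qed.

Lemma weight_le_exists x : exists e, weight_le e x.
Proof.
exists (\max_(i < p) (p * deg x`_i + i * deg f))%N => i _.
exact: (leq_bigmax (F := fun i : 'I_p => p * deg x`_i + i * deg f)%N i).
Qed.

(** The image of x in degree e of the associated graded ring is nilpotent. *)
Definition weight_drops e x : Prop :=
  weight_le e x /\ exists2 n, (0 < n)%N & weight_le (n * e).-1 (x ^+ n).

Lemma weight_drops_expD e x n i : (0 < e)%N -> weight_le e x -> (0 < n)%N ->
  weight_le (n * e).-1 (x ^+ n) -> weight_le ((n + i) * e).-1 (x ^+ (n + i)).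
Proof.
move=> e0 xe n0 xn; rewrite exprD.
apply: (weight_le_mono _ (weight_leM xn (weight_leX (n := i) xe))).
by have : (0 < n * e)%N; [rewrite muln_gt0 n0|nia].
Qed.

(** A sum of two commuting nilpotents is nilpotent: every term of the binomial
    expansion of (x + y)^(a + b) contains x^a or y^b. *)
Lemma weight_dropsD e x y : (0 < e)%N ->
  weight_drops e x -> weight_drops e y -> weight_drops e (x + y).
Proof.
move=> e0 [xe [a a0 xa]] [ye [b b0 yb]]; split; first exact: weight_leD.
exists (a + b)%N; first by rewrite addn_gt0 a0.
rewrite exprDn; apply: weight_le_sum => i _; apply: weight_leMn.
have le_i : (i <= a + b)%N by rewrite -ltnS.
have pos n : (0 < n -> 0 < n * e)%N by move=> n0; rewrite muln_gt0 n0.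
have sumE : ((a + b - i) * e + i * e = (a + b) * e)%N by rewrite -mulnDl subnK.
have [le_bi|lt_ib] := leqP b i.
  have yi : weight_le (i * e).-1 (y ^+ i).
    by rewrite -(subnKC le_bi); apply: weight_drops_expD.
  apply: (weight_le_mono _ (weight_leM (weight_leX (n := a + b - i) xe) yi)).
  by rewrite -sumE -!subn1 addnBA // pos // (leq_trans b0).
have le_ai : (a <= a + b - i)%N by lia.
have xi : weight_le ((a + b - i) * e).-1 (x ^+ (a + b - i)).
  by rewrite -(subnKC le_ai); apply: weight_drops_expD.
apply: (weight_le_mono _ (weight_leM xi (weight_leX (n := i) ye))).
by rewrite -sumE -!subn1 addnBAC // pos // (leq_trans a0).
Qed.

Lemma weight_drops0 e : weight_drops e 0.
Proof.
by split; [exact: weight_le0 | exists 1%N => //; apply: weight_le0].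
Qed.

Lemma weight_drops_scale_gal e c j x :
  weight_drops e x -> weight_drops e (cst c *: gal j x).
Proof.
move=> [xe [n n0 xn]]; split; first exact/weight_le_scale/weight_le_gal.
exists n => //; rewrite exprZn -rmorphXn; apply: weight_le_scale.
have -> : gal j x ^+ n = gal j (x ^+ n).
  elim: n {n0 xn} => [|n IH]; rewrite ?exprS ?(galM zP) ?IH //.
  by rewrite !expr0 rmorph1.
exact: weight_le_gal.
Qed.

(** (a z^i)^(n p) = a^(n p) f^(i n) lies in A, where the degree is additive; so
    no power of a z^i drops below the expected weight. *)
Lemma weight_drops_monomial e (a : A) i : (0 < e)%N -> a != 0 ->
  weight_drops e (a *: z ^+ i) -> (p * deg a + i * deg f < e)%N.
Proof.
move=> e0 a0 [_ [n n0 an]].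
have powE : ((a *: z ^+ i) ^+ n) ^+ p = (a ^+ (n * p) * f ^+ (i * n))%:A.
  rewrite -exprM exprZn -exprM mulnA [in z ^+ _]mulnC (exprM z) radicalX //.
  by rewrite exprZn expr1n scalerA.
have b0 : a ^+ (n * p) * f ^+ (i * n) != 0 by rewrite mulf_neq0 ?expf_neq0.
have anp := weight_leX (n := p) an.
have := anp (Ordinal p_gt0); rewrite powE alg_coef0 => /(_ b0) /=.
rewrite degM ?expf_neq0 // !degX // mul0n addn0 leq_pmul2l //.
rewrite -[X in (X + _)%N]mulnA [(i * n)%N]mulnC -mulnA -mulnDr.
rewrite -(ltn_pmul2l n0) => /leq_ltn_trans; apply.
by rewrite prednK // muln_gt0 n0.
Qed.

(** The associated graded ring is reduced.  If the leading form of x is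
    nilpotent, so are the leading forms of its isotypic components p x_i z^i,
    which are combinations of conjugates of x, and these components are
    monomials. *)
Lemma weight_drops_pred e x : (0 < e)%N -> weight_drops e x -> weight_le e.-1 x.
Proof.
move=> e0 xd i x0; rewrite -ltnS prednK //.
have px0 : p%:R * x`_i != 0.
  by rewrite mulf_neq0 // -(rmorph_nat cst) fmorph_eq0.
have : weight_drops e ((p%:R * x`_i) *: z ^+ i).
  rewrite -(trace_gal zP) //; elim/big_ind: _ => [|y w|j _].
  - exact: weight_drops0.
  - exact: weight_dropsD.
  - by rewrite -rmorphXn; apply: weight_drops_scale_gal.
move/(weight_drops_monomial e0 px0).
by rewrite degM // -?(rmorph_nat cst) ?deg_cst ?fmorph_eq0.
Qed.

(** If u = w^p, the weight of w is smaller than that of u as long as the latter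
    is positive, and w is again a principal unit. *)
Lemma principal_unit_weight e u :
  principal_unit u -> weight_le e u -> weight_le 0 u.
Proof.
elim: e u => // e IH u Pu ue.
have [w Pw uw] := principal_unit_pth_power Pu.
have wX e0 : weight_le e0 w -> weight_le e w.
  elim: e0 => [|e0 IH0] we0; first exact: (weight_le_mono _ we0).
  have [le_e|lt_e] := leqP e0.+1 e; first exact: (weight_le_mono _ we0).
  apply: IH0; apply: (weight_drops_pred (e := e0.+1)) => //; split=> //.
  exists p => //; rewrite -uw; apply: (weight_le_mono _ ue).
  by rewrite ltnS in lt_e; nia.
have [e0 /wX we] := weight_le_exists w.
by rewrite uw -(muln0 p); apply/weight_leX/IH.
Qed.

Lemma weight_le0_const x : weight_le 0 x -> exists c, x = (cst c)%:A.
Proof.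
move=> x0.
have [c cE] : exists c, x`_0 = cst c.
  have [->|/(x0 (Ordinal p_gt0))] := eqVneq x`_0 0.
    by exists 0; rewrite rmorph0.
  by rewrite mul0n addn0 leqn0 muln_eq0 (gtn_eqF p_gt0) => /eqP/deg0_cst.
exists c; apply: (radicalP p_gt0) => -[|i] lt_ip.
  by rewrite alg_coef0.
rewrite coefZ_radical [(1 : T)`_i.+1]coefC mulr0.
apply/eqP/negPn/negP => /(x0 (Ordinal lt_ip)).
by rewrite leqn0 addn_eq0 !muln_eq0 (gtn_eqF deg_f_gt0) andbF.
Qed.

Theorem radical_units x : is_unit x <-> exists2 c, c != 0 & x = (cst c)%:A.
Proof.
split=> [xU|[c c0 ->]]; last first.
  exists (cst c^-1)%:A; rewrite -scalerAl mul1r scalerA -rmorphM mulVf //.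
  by rewrite rmorph1 scale1r.
have [g [u [g0 Pu xE]]] := unit_scale xU.
have [e ue] := weight_le_exists u.
have [c uE] := weight_le0_const (principal_unit_weight Pu ue).
exists (g * c); last by rewrite xE uE scalerA -rmorphM.
rewrite mulf_neq0 //; apply/eqP => c0; have [y] := xU.
rewrite xE uE c0 rmorph0 scale0r scaler0 mulr0 => /esym/eqP.
by rewrite oner_eq0.
Qed.

End Units.

(** * Units of k[x_1, .., x_m][z]/(z^p - f) *)
Theorem theorem2p10 (k : closedFieldType) (m : nat) (hm : (1 <= m)%N)
    (f : {mpoly k[m]}) (hf : irreducible_elt f)
    (p : nat) (hp : prime p) (hpk : (p%:R : k) \is a GRing.unit) :
  forall u : {poly %/ ('X^p - f%:P)},
    is_unit u <->
    exists2 c : k, c \is a GRing.unit & u = qpolyC ('X^p - f%:P) c%:MP.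
Proof.
move=> u; have p0 : (p%:R : k) != 0 by rewrite -unitfE.
have [zeta zetaP] := closed_prim_root hp p0.
pose deg (a : {mpoly k[m]}) := (msize a).-1.
have degM a b : a != 0 -> b != 0 -> deg (a * b) = (deg a + deg b)%N.
  move=> a0 b0; rewrite /deg msizeM //.
  by rewrite (mpolySpred _ a0) (mpolySpred _ b0) addnS.
have degC c : deg c%:MP = 0 by rewrite /deg msizeC; case: eqP.
have deg0 a : deg a = 0 -> exists c, a = c%:MP.
  move=> a0; exists (a@_0%MM); apply: msize1_polyC.
  by move: a0; rewrite /deg; case: (msize a) => [|[]].
have degD (a b : {mpoly k[m]}) : (deg (a + b)%R <= maxn (deg a) (deg b))%N.
  have := mmeasureD_le mdeg a b; rewrite /deg !leq_max -!subn1.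
  by case/orP => /(leq_sub2r 1)->; rewrite ?orbT.
pose cst : {rmorphism k -> {mpoly k[m]}} := @mpolyC m k.
have := @radical_units k {mpoly k[m]} cst deg degM degC deg0
  (irreducible_is_prime_mpoly (n := m)) f p zeta hf hp p0 zetaP degD u.
have cstE c : qpolyC ('X^p - f%:P) c%:MP = (cst c)%:A.
  by rewrite qpolyC_alg ?prime_gt0.
move=> ->; split=> [] [c cU ->]; exists c; rewrite ?cstE //.
  by rewrite unitfE.
by rewrite -unitfE.
Qed.
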